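(* For every partition $j$, the closed convex cone $\mathcal C^j\subset\mathcal H^j$ has the Fenchel–Moreau property: for every $g:\mathcal C^j\to(-\infty,\infty]$ not identically equal to $\infty$, one has $g^{**}=g$ on $\mathcal C^j$ if and only if $g$ is convex, lower semicontinuous and $(\mathcal C^j)^*$-increasing.
   Context: Fix an integer $D\ge1$. $\mathbb S^D$ is the space of real symmetric $D\times D$ matrices with inner product $a\cdot b=\mathrm{tr}(ab)$; $\mathbb S^D_+$ is the cone of positive semidefinite matrices; $a\ge b$ means $a-b\in\mathbb S^D_+$. A partition is a tuple $j=(t_1,\dots,t_n)$ with $0<t_1<\dots<t_n=1$; $|j|=n$, $t_0=0$. $\mathcal H^j=(\mathbb S^D)^{|j|}$ with inner product $\langle x,y\rangle_{\mathcal H^j}=\sum_{k=1}^{|j|}(t_k-t_{k-1})x_k\cdot y_k$; $\mathcal C^j=\{x\in\mathcal H^j:0\le x_1\le x_2\le\dots\le x_{|j|}\}$; $(\mathcal C^j)^*=\{x\in\mathcal H^j:\langle x,y\rangle_{\mathcal H^j}\ge0\ \forall y\in\mathcal C^j\}$. A function $g$ on $\mathcal C^j$ is $(\mathcal C^j)^*$-increasing if $g(x)\ge g(x')$ for all $x,x'\in\mathcal C^j$ with $x-x'\in(\mathcal C^j)^*$. The monotone conjugate is $g^*(y)=\sup_{x\in\mathcal C^j}\{\langle x,y\rangle_{\mathcal H^j}-g(x)\}$ for $y\in\mathcal H^j$, and $g^{**}(x)=\sup_{y\in\mathcal C^j}\{\langle y,x\rangle_{\mathcal H^j}-g^*(y)\}$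 (both suprema are over the cone $\mathcal C^j$). *)

(* Defs.v *)
From mathcomp Require Import all_boot all_order all_algebra.
From mathcomp Require Import all_classical all_reals all_analysis.
Set Implicit Arguments.
Unset Strict Implicit.
Unset Printing Implicit Defensive.
Import Order.TTheory GRing.Theory Num.Theory.
Import numFieldNormedType.Exports.
(* The function type 'I_n -> 'M_D gets the product topology.  The matrices have
   the topology of the entries, so this is the topology of the norm of H^j. *)
Import ArrowAsProduct.

Local Open Scope classical_set_scope.
Local Open Scope ring_scope.

(* The sequence [:: t_1; ...; t_n] of a partition 0 = t_0 < t_1 < ... < t_n = 1.
   The empty sequence is excluded, since [last 0 [::] = 0]. *)
Record time_partition (R : realType) := TimePartition {
  times :> seq R ;
  times_increasing : path <%R 0 times ;
  times_last : last 0 times = 1 }.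

Section cone.
Variables (R : realType) (D : nat).

Definition psd (a : 'M[R]_D) : Prop :=
  a \is symmetricmx /\ forall v : 'cV[R]_D, 0 <= (v^T *m a *m v) 0 0.

Definition psd_le (a b : 'M[R]_D) : Prop := psd (b - a).

Variable j : time_partition R.

(* H^j is the subset [path_space] of this type: coordinates are symmetric. *)
Local Notation path_type := ('I_(size j) -> 'M[R]_D).

Definition path_space : set path_type :=
  [set x | forall k, x k \is symmetricmx].

(* The index k : 'I_n stands for k + 1 in 1..n, and [nth 0 (0 :: j) k] is t_k,
   so that the weight below is t_(k+1) - t_k. *)
Definition path_dot (x y : path_type) : R :=
  \sum_(k < size j)
    (nth 0 (0 :: times j) k.+1 - nth 0 (0 :: times j) k) * \tr (x k *m y k).

Definition path_cone : set path_type :=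
  [set x | [/\ path_space x,
               forall k : 'I_(size j), k = 0%N :> nat -> psd_le 0 (x k) &
               forall i k : 'I_(size j), k = i.+1 :> nat ->
                 psd_le (x i) (x k)]].

Definition dual_path_cone : set path_type :=
  [set x | path_space x /\ forall y, path_cone y -> 0 <= path_dot x y].

(* Functions on C^j are represented by functions on the whole of [path_type];
   all notions below only depend on the values on C^j. *)
Implicit Types g : path_type -> \bar R.

Definition monotone_conjugate g (y : path_type) : \bar R :=
  ereal_sup [set ((path_dot x y)%:E - g x)%E | x in path_cone].

Definition monotone_biconjugate g (x : path_type) : \bar R :=
  ereal_sup [set ((path_dot y x)%:E - monotone_conjugate g y)%E
            | y in path_cone].

(* The library's [convex_function] is restricted to real values; here g takes
   values in ]-oo, +oo], with 0 * +oo = 0. *)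
Definition convex_on_cone g : Prop :=
  forall x y (s : R), path_cone x -> path_cone y -> 0 <= s <= 1 ->
    (g (s *: x + (1 - s) *: y)%R <= s%:E * g x + (1 - s)%:E * g y)%E.

Definition lsc_on_cone g : Prop :=
  lower_semicontinuous (g : subspace path_cone -> \bar R).

Definition dual_increasing g : Prop :=
  forall x x', path_cone x -> path_cone x' -> dual_path_cone (x - x') ->
    (g x' <= g x)%E.

Definition closed_convex_cone (C : set path_type) : Prop :=
  [/\ closed C, convex_set (C : set (convex_lmodType path_type)), C 0 &
      forall (a : R) x, 0 <= a -> C x -> C (a *: x)].

Definition fenchel_moreau_property : Prop :=
  forall g,
    (forall x, path_cone x -> (-oo < g x)%E) ->
    (exists2 x, path_cone x & g x <> +oo%E) ->
    (forall x, path_cone x -> monotone_biconjugate g x = g x) <->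
    [/\ convex_on_cone g, lsc_on_cone g & dual_increasing g].

End cone.

Arguments path_cone {R} D j _.
Arguments fenchel_moreau_property {R} D j.

(* Main.v *)
Require Import Defs.
From mathcomp Require Import all_boot all_order all_algebra.
From mathcomp Require Import all_classical all_reals all_analysis.
From mathcomp Require Import ring lra.
Set Implicit Arguments.
Unset Strict Implicit.
Unset Printing Implicit Defensive.
Import Order.TTheory GRing.Theory Num.Theory.
Import numFieldNormedType.Exports.
Import ArrowAsProduct.

Local Open Scope classical_set_scope.
Local Open Scope ring_scope.

(* Write T_k x = sum_(i >= k) w_i x_i for the weighted tail sums of a path.  By
   Abel summation, the dual of C^j is { x | T_k x >= 0 for all k }, and in
   particular it contains C^j.  Hence 0 minimises an increasing g.

   Let g be convex, lower semicontinuous and increasing, and extend it to H^j by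
   h(z) = inf { g x | x in C^j, x - z in the dual cone }.  Affine minorants of h
   have slopes in the bidual cone, which is C^j, so it suffices that h is lower
   semicontinuous at every x0 in C^j: points z of a sublevel set {h <= b} with
   b < g x0 stay away from x0.  Then b - l |z - x0|_1 <= h z for l large, and a
   Hahn-Banach argument puts an affine function between the two sides.

   For the semicontinuity, suppose that x >= z in the dual order, g x <= b and z
   is close to x0.  Choose p in K = {g <= b} whose last (largest) coordinate has
   maximal rank.  By convexity the kernel of that coordinate annihilates all
   members of K, and also x0.  So the bound T_k x - T_k x0 >= T_k (z - x0), in
   which the right-hand side is small, improves to
   T_k x - T_k x0 >= - (small) T_k p, whence
   (1 - s) x0 <= (1 - s) x + s p in the dual order.  Thus (1 - s) x0 is in K for
   every s > 0, and x0 is in K by lower semicontinuity. *)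

(** * Positive semidefinite matrices *)

Section psd.
Variables (R : realType) (D : nat).
Implicit Types (a b p : 'M[R]_D) (u v w : 'cV[R]_D).

Lemma symmetricmxP a : a \is symmetricmx <-> a^T = a.
Proof.
split => [/is_hermitianmxP|ha].
  by rewrite expr0 scale1r map_mx_id// => {2}->.
by apply/is_hermitianmxP; rewrite expr0 scale1r map_mx_id.
Qed.

Lemma symmetricmxE a : a \is symmetricmx -> forall c d, a c d = a d c.
Proof. by move=> /symmetricmxP ha c d; rewrite -{1}ha mxE. Qed.

Lemma symmetricmxB a b :
  a \is symmetricmx -> b \is symmetricmx -> a - b \is symmetricmx.
Proof.
by move=> /symmetricmxP ha /symmetricmxP hb; apply/symmetricmxP;
  rewrite linearB/= ha hb.
Qed.

Lemma symmetricmxD a b :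
  a \is symmetricmx -> b \is symmetricmx -> a + b \is symmetricmx.
Proof.
by move=> /symmetricmxP ha /symmetricmxP hb; apply/symmetricmxP;
  rewrite linearD/= ha hb.
Qed.

Lemma symmetricmxZ (s : R) a : a \is symmetricmx -> s *: a \is symmetricmx.
Proof. by move=> /symmetricmxP ha; apply/symmetricmxP; rewrite linearZ/= ha. Qed.

Lemma symmetricmx0 : (0 : 'M[R]_D) \is symmetricmx.
Proof. by apply/symmetricmxP; rewrite trmx0. Qed.

Definition mxform a u v : R := (u^T *m a *m v) 0 0.

Lemma formE a u v : mxform a u v = \sum_c \sum_d u c 0 * a c d * v d 0.
Proof.
rewrite /mxform mxE exchange_big; apply: eq_bigr => d _.
by rewrite mxE mulr_suml; apply: eq_bigr => c _; rewrite !mxE.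
Qed.

Lemma formDl a u1 u2 v : mxform a (u1 + u2) v = mxform a u1 v + mxform a u2 v.
Proof. by rewrite /mxform linearD/= !mulmxDl mxE. Qed.

Lemma formDr a u v1 v2 : mxform a u (v1 + v2) = mxform a u v1 + mxform a u v2.
Proof. by rewrite /mxform mulmxDr mxE. Qed.

Lemma formZl a s u v : mxform a (s *: u) v = s * mxform a u v.
Proof. by rewrite /mxform linearZ/= -!scalemxAl mxE. Qed.

Lemma formZr a s u v : mxform a u (s *: v) = s * mxform a u v.
Proof. by rewrite /mxform -scalemxAr mxE. Qed.

Lemma formDm a b u v : mxform (a + b) u v = mxform a u v + mxform b u v.
Proof. by rewrite /mxform mulmxDr mulmxDl mxE. Qed.

Lemma formZm s a u v : mxform (s *: a) u v = s * mxform a u v.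
Proof. by rewrite /mxform -scalemxAr -scalemxAl mxE. Qed.

Lemma formNm a u v : mxform (- a) u v = - mxform a u v.
Proof. by rewrite -scaleN1r formZm mulN1r. Qed.

Lemma formBm a b u v : mxform (a - b) u v = mxform a u v - mxform b u v.
Proof. by rewrite formDm formNm. Qed.

Lemma form0m u v : mxform 0 u v = 0.
Proof. by rewrite /mxform mulmx0 mul0mx mxE. Qed.

Lemma tr11 (x : 'M[R]_1) : x 0 0 = x^T 0 0.
Proof. by rewrite mxE. Qed.

Lemma formC a u v : a \is symmetricmx -> mxform a u v = mxform a v u.
Proof.
move=> /symmetricmxP ha; rewrite /mxform [RHS]tr11 !trmx_mul trmxK ha.
by rewrite mulmxA.
Qed.

Lemma form_delta a c v : mxform a (delta_mx c 0) v = (a *m v) c 0.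
Proof. by rewrite /mxform trmx_delta -mulmxA -rowE mxE. Qed.

Lemma form_delta2 a c d : mxform a (delta_mx c 0) (delta_mx d 0) = a c d.
Proof. by rewrite form_delta -colE mxE. Qed.

Lemma form_kerr a u v : a *m v = 0 -> mxform a u v = 0.
Proof. by move=> av; rewrite /mxform -mulmxA av mulmx0 mxE. Qed.

Lemma psdP a : psd a <-> a \is symmetricmx /\ forall v, 0 <= mxform a v v.
Proof. by []. Qed.

Lemma psd_sym a : psd a -> a \is symmetricmx.
Proof. by case. Qed.

Lemma psd_form a v : psd a -> 0 <= mxform a v v.
Proof. by case=> _; exact. Qed.

Lemma psd0 : psd (0 : 'M[R]_D).
Proof. by apply/psdP; split=> [|v]; [exact: symmetricmx0|rewrite form0m]. Qed.

Lemma psdD a b : psd a -> psd b -> psd (a + b).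
Proof.
move=> pa pb; apply/psdP; split=> [|v]; first exact/symmetricmxD/psd_sym/pb/psd_sym.
by rewrite formDm addr_ge0// psd_form.
Qed.

Lemma psdZ s a : 0 <= s -> psd a -> psd (s *: a).
Proof.
move=> s0 pa; apply/psdP; split=> [|v]; first exact/symmetricmxZ/psd_sym.
by rewrite formZm mulr_ge0// psd_form.
Qed.

Lemma psd_sum (I : Type) (r : seq I) (P : pred I) (F : I -> 'M[R]_D) :
  (forall i, P i -> psd (F i)) -> psd (\sum_(i <- r | P i) F i).
Proof. by move=> PF; elim/big_ind : _ => //; [exact: psd0|exact: psdD]. Qed.

Lemma psd_le0 a : psd_le 0 a <-> psd a. Proof. by rewrite /psd_le subr0. Qed.

Lemma psd_outer u : psd (u *m u^T).
Proof.
apply/psdP; split=> [|v].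
  by apply/symmetricmxP; rewrite trmx_mul trmxK.
rewrite /mxform mulmxA -mulmxA mxE big_ord1.
suff -> : (v^T *m u) 0 0 = (u^T *m v) 0 0 by rewrite -expr2 sqr_ge0.
by rewrite tr11 trmx_mul trmxK.
Qed.

Lemma mxtrace_outer a u v : \tr (a *m (u *m v^T)) = mxform a v u.
Proof. by rewrite mulmxA mxtrace_mulC mulmxA /mxtrace big_ord1. Qed.

(** The form at s u + t v is a nonnegative quadratic polynomial in s and t; suitable values of s and
    t give the discriminant inequality. *)
Lemma psd_CauchySchwarz a u v : psd a ->
  mxform a u v ^+ 2 <= mxform a u u * mxform a v v.
Proof.
move=> pa.
have quad s t : mxform a (s *: u + t *: v) (s *: u + t *: v) =
    s ^+ 2 * mxform a u u + 2 * s * t * mxform a u v + t ^+ 2 * mxform a v v.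
  rewrite !(formDl, formDr, formZl, formZr) (formC v u (psd_sym pa)); ring.
have pos s t : 0 <= s ^+ 2 * mxform a u u + 2 * s * t * mxform a u v
    + t ^+ 2 * mxform a v v.
  by rewrite -quad psd_form.
have [v0|v0] := eqVneq (mxform a v v) 0.
  have [->|uv] := eqVneq (mxform a u v) 0; first by rewrite v0 mulr0 expr0n.
  (* With the t^2 term absent, this t gives the quadratic the value -1. *)
  have := pos 1 (- (mxform a u u + 1) / (2 * mxform a u v)).
  rewrite v0 expr1n mul1r mulr0 addr0 mulr1.
  suff -> : 2 * (- (mxform a u u + 1) / (2 * mxform a u v)) * mxform a u v
      = - (mxform a u u + 1) by lra.
  by field; rewrite uv.
have vpos : 0 < mxform a v v by rewrite lt_def v0 psd_form.
have := pos (mxform a v v) (- mxform a u v); set x := mxform a v v.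
set y := mxform a u v; set z := mxform a u u.
rewrite (_ : _ + _ = x * (z * x - y ^+ 2)); last by ring.
by rewrite pmulr_rge0// subr_ge0.
Qed.

Lemma psd_ker a v : psd a -> mxform a v v = 0 -> a *m v = 0.
Proof.
move=> pa v0; apply/matrixP => c d; rewrite ord1 !mxE.
have := psd_CauchySchwarz (delta_mx c 0) v pa.
rewrite v0 mulr0 form_delta => h.
have : ((a *m v) c 0) ^+ 2 == 0 by rewrite eq_le h sqr_ge0.
by rewrite sqrf_eq0 mxE => /eqP.
Qed.

(* Each step of the induction subtracts from [b] the rank-one matrix that
   clears a nonzero diagonal entry, so that [b] ends up as a sum of [u u^T]. *)
Lemma psd_trace_ge0 a b : psd a -> psd b -> 0 <= \tr (a *m b).
Proof.
move=> pa; have [n] := ubnP #|[pred c | b c c != 0]|.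
elim: n b => // n IH b; rewrite ltnS => bn pb.
have [c bc|b0] := pickP [pred c | b c c != 0]; last first.
  suff -> : b = 0 by rewrite mulmx0 mxtrace0.
  apply/matrixP => c d.
  have /eqP dd := negbFE (b0 d).
  rewrite -form_delta2 (form_kerr _ (psd_ker pb _)) ?mxE//.
  by rewrite form_delta2.
rewrite inE in bc.
have diag d : 0 <= b d d by rewrite -form_delta2 psd_form.
have bpos : 0 < b c c by rewrite lt_def bc diag.
pose u := b *m delta_mx c 0 : 'cV[R]_D.
pose b' := b - (b c c)^-1 *: (u *m u^T).
have sb := psd_sym pb.
have form_u v : mxform (u *m u^T) v v = mxform b (delta_mx c 0) v ^+ 2.
  rewrite /mxform mulmxA -mulmxA mxE big_ord1 /u expr2; congr (_ * _).
    by rewrite mulmxA -/(mxform b v _) formC.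
  by rewrite trmx_mul; move/symmetricmxP: sb => ->.
have form_b' v : mxform b' v v =
    mxform b v v - (b c c)^-1 * mxform b (delta_mx c 0) v ^+ 2.
  by rewrite /b' formBm formZm form_u.
have pb' : psd b'.
  apply/psdP; split=> [|v].
    exact/symmetricmxB/symmetricmxZ/psd_sym/psd_outer.
  rewrite form_b' subr_ge0 ler_pdivrMl//.
  by have := psd_CauchySchwarz (delta_mx c 0) v pb; rewrite form_delta2.
have -> : b = b' + (b c c)^-1 *: (u *m u^T) by rewrite /b' subrK.
rewrite mulmxDr linearD/= -scalemxAr linearZ/= mxtrace_outer.
rewrite addr_ge0 ?mulr_ge0 ?invr_ge0 ?psd_form ?(ltW bpos)//.
apply: IH => //; apply: leq_trans bn; apply: proper_card.
have b'E d : b' d d = b d d - (b c c)^-1 * b c d ^+ 2.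
  by rewrite -[LHS]form_delta2 form_b' !form_delta2.
apply/fintype.properP; split.
  (* Diagonal zeros persist: where b d d = 0, the entry b' d d is minus a multiple of a square, yet
     nonnegative. *)
  apply/fintype.subsetP => d; rewrite !inE; apply: contra => /eqP bd0.
  have : 0 <= b' d d by rewrite -form_delta2 psd_form.
  rewrite b'E bd0 sub0r => h.
  have := sqr_ge0 (b c d); rewrite le_eqVlt => /predU1P[<-|bcd].
    by rewrite mulr0 oppr0.
  by move: h; rewrite oppr_ge0 leNgt mulr_gt0// invr_gt0.
by exists c; rewrite !inE// b'E expr2 mulrA mulVf// mul1r subrr eqxx.
Qed.

Lemma psd_ker_le a b v : psd a -> psd_le a b -> b *m v = 0 -> a *m v = 0.
Proof.
move=> pa ab bv; apply: psd_ker => //; apply/eqP; rewrite eq_le psd_form// andbT.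
by rewrite -(form_kerr v bv) -subr_ge0 -formBm psd_form.
Qed.

(** Modulo the kernel of p, a vector v may be replaced by w = p^- p v, with p^- a generalized
    inverse. Cauchy-Schwarz bounds each w_c^2 by S times the form of p at v, so the form of m at w
    is at least - C e times that of p at v, where C depends on p alone. *)
Lemma psd_dom p : psd p -> exists2 C, 0 <= C &
  forall (b m : 'M[R]_D) (e : R), b \is symmetricmx ->
    (forall u, p *m u = 0 -> b *m u = 0) -> psd (b - m) -> (forall c d, `|m c d| <= e) -> psd (b + (C * e) *: p).
Proof.
move=> pp; pose G c := (row c (pinvmx p))^T.
pose S := \sum_c mxform p (G c) (G c).
have S0 : 0 <= S by apply: sumr_ge0 => c _; rewrite psd_form.
exists ((\sum_(c < D) \sum_(d < D) 1) * S).
  by rewrite mulr_ge0// !sumr_ge0// => c _; rewrite sumr_ge0.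
move=> b m e sb ker pbm me; apply/psdP; split=> [|v].
  exact/symmetricmxD/symmetricmxZ/psd_sym/pp.
pose w := pinvmx p *m p *m v; pose u := v - w.
have pu : p *m u = 0.
  by rewrite /u mulmxBr /w [X in _ - X]mulmxA [p *m (_ *m _)]mulmxA mulmxKpV// subrr.
have bu := ker _ pu.
have vE : v = u + w by rewrite /u subrK.
have -> : mxform (b + ((\sum_(c < D) \sum_(d < D) 1) * S * e) *: p) v v =
    mxform b w w + \sum_(c < D) \sum_(d < D) e * (S * mxform p v v).
  rewrite formDm formZm; congr (_ + _).
    rewrite vE formDr (form_kerr _ bu) add0r formDl (formC u w sb).
    by rewrite (form_kerr _ bu) add0r.
  rewrite -!mulrA mulr_suml; apply: eq_bigr => c _.
  by rewrite mulr_suml; apply: eq_bigr => d _; ring.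
have wS c : w c 0 ^+ 2 <= S * mxform p v v.
  have -> : w c 0 = mxform p (G c) v.
    by rewrite /mxform trmxK -!row_mul [RHS]mxE.
  apply: (le_trans (psd_CauchySchwarz _ _ pp)).
  rewrite ler_wpM2r ?psd_form// /S (bigD1 c)//= lerDl.
  by apply: sumr_ge0 => d _; rewrite psd_form.
have := psd_form w pbm; rewrite formBm => /le_trans -> //.
rewrite lerD2l formE -sumrN; apply: ler_sum => c _.
rewrite -sumrN; apply: ler_sum => d _.
have e0 : 0 <= e by rewrite (le_trans _ (me c d)).
apply: (le_trans (ler_norm _)); rewrite normrN !normrM mulrAC mulrC.
rewrite ler_pM ?mulr_ge0//.
have := wS c; have := wS d; rewrite -(real_normK (num_real (w c 0))).
rewrite -(real_normK (num_real (w d 0))).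
have := sqr_ge0 (`|w c 0| - `|w d 0|); rewrite sqrrB; nra.
Qed.
End psd.

(** Positivity gives ker (p + x) <= ker p, and the rank bound turns this inclusion into an equality.
    Row kernels are used, which symmetry identifies with column kernels. *)
Lemma psd_rank_ker (R : realType) (D : nat) (p x : 'M[R]_D) (u : 'cV[R]_D) :
  psd p -> psd x -> (\rank (p + x)%R <= \rank p)%N -> p *m u = 0 -> x *m u = 0.
Proof.
move=> pp px rk pu.
have tr0 (a : 'M[R]_D) (v : 'rV[R]_D) : psd a -> (v *m a == 0) = (a *m v^T == 0).
  move=> /psd_sym/symmetricmxP ha; rewrite -(inj_eq trmx_inj) trmx_mul ha trmx0.
  by [].
have sub : (kermx (p + x) <= kermx p)%MS.
  apply/row_subP => i; apply/sub_kermxP/eqP; rewrite tr0//.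
  set v := row i _; have : v *m (p + x) = 0.
    by apply/sub_kermxP; rewrite row_sub.
  move/eqP; rewrite (tr0 _ _ (psdD pp px)) => /eqP h.
  have := form_kerr v^T h; rewrite formDm => /eqP.
  rewrite paddr_eq0 ?psd_form// => /andP[/eqP p0 _].
  by apply/eqP/psd_ker.
have /eqmxP eqk : (kermx (p + x) == kermx p)%MS.
  rewrite -(mxrank_leqif_eq sub) eqn_leq mxrankS//= !mxrank_ker.
  by rewrite leq_sub2l.
have : (p + x) *m u = 0.
  have := tr0 _ u^T (psdD pp px); rewrite trmxK => uE; apply/eqP; rewrite -uE.
  apply/eqP/sub_kermxP; rewrite eqk; apply/sub_kermxP/eqP.
  by rewrite tr0// trmxK pu.
by rewrite mulmxDl pu add0r.
Qed.

(** * Tail sums and the dual cone *)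

Section cone.
Variables (R : realType) (D : nat) (j : time_partition R).
Local Notation path_type := ('I_(size j) -> 'M[R]_D).
Implicit Types (x y z v : path_type) (k i : 'I_(size j)).

Definition weight (m : nat) : R := nth 0 (0 :: times j) m.+1 - nth 0 (0 :: times j) m.

Lemma weight_gt0 k : 0 < weight k.
Proof.
rewrite subr_gt0; have /(pathP 0) := times_increasing j.
exact.
Qed.

Lemma size_partition_gt0 : (0 < size j)%N.
Proof.
rewrite lt0n; apply/eqP => /size0nil j0.
by have /eqP := times_last j; rewrite j0/= eq_sym oner_eq0.
Qed.

Lemma pred_size_partition : ((size j).-1 < size j)%N.
Proof. by rewrite ltn_predL; exact: size_partition_gt0. Qed.

Definition last_index : 'I_(size j) := Ordinal pred_size_partition.

Lemma leq_last_index k : (k <= last_index)%N.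
Proof. by rewrite /= -ltnS prednK ?size_partition_gt0. Qed.

Lemma path_dotDl x y z : path_dot (x + y) z = path_dot x z + path_dot y z.
Proof.
rewrite -big_split; apply: eq_bigr => k _.
by rewrite mulmxDl linearD/= mulrDr.
Qed.

Lemma path_dotZl s x z : path_dot (s *: x) z = s * path_dot x z.
Proof.
rewrite mulr_sumr; apply: eq_bigr => k _.
by rewrite -scalemxAl linearZ/= mulrCA.
Qed.

Lemma path_dotC x y : path_dot x y = path_dot y x.
Proof. by apply: eq_bigr => k _; rewrite mxtrace_mulC. Qed.

Lemma path_dotBl x y z : path_dot (x - y) z = path_dot x z - path_dot y z.
Proof. by rewrite path_dotDl -scaleN1r path_dotZl mulN1r. Qed.

Lemma path_dotBr x y z : path_dot x (y - z) = path_dot x y - path_dot x z.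
Proof. by rewrite path_dotC path_dotBl ![path_dot _ x]path_dotC. Qed.

Lemma path_dotDr x y z : path_dot x (y + z) = path_dot x y + path_dot x z.
Proof. by rewrite path_dotC path_dotDl ![path_dot _ x]path_dotC. Qed.

Lemma path_dotZr s x z : path_dot x (s *: z) = s * path_dot x z.
Proof. by rewrite path_dotC path_dotZl path_dotC. Qed.

Lemma path_spaceD x y : path_space x -> path_space y -> path_space (x + y).
Proof. by move=> hx hy k; apply: symmetricmxD. Qed.

Lemma path_spaceB x y : path_space x -> path_space y -> path_space (x - y).
Proof. by move=> hx hy k; apply: symmetricmxB. Qed.

Lemma path_spaceZ s x : path_space x -> path_space (s *: x).
Proof. by move=> hx k; apply: symmetricmxZ. Qed.

Lemma path_cone_space x : path_cone D j x -> path_space x.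
Proof. by case. Qed.

(** A sum with at most one term: it is empty for the first index, which encodes the convention x_0 =
    0, and it is visibly linear in x. *)
Definition prev x k : 'M[R]_D := \sum_(i < size j | k == i.+1 :> nat) x i.

Lemma prev_S x k i : k = i.+1 :> nat -> prev x k = x i.
Proof.
by move=> ki; rewrite /prev (big_pred1 i)// => i'; rewrite ki eqSS eq_sym.
Qed.

Lemma prev_0 x k : k = 0%N :> nat -> prev x k = 0.
Proof. by move=> k0; rewrite /prev big_pred0// => i; rewrite k0. Qed.

Lemma path_coneP x : path_cone D j x <->
  path_space x /\ forall k, psd (x k - prev x k).
Proof.
split=> [[sx x0 xS]|[sx xk]].
  split=> // k; case k0 : (k : nat) => [|m].
    by rewrite (prev_0 _ k0) subr0; apply: (psd_le0 _).1; exact: x0.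
  have mn : (m < size j)%N by rewrite -ltnS -k0 ltnW// ltnS.
  by rewrite (prev_S x (k0 : k = (Ordinal mn).+1 :> nat)); apply: xS.
split=> // [k k0|i k ki].
  by have := xk k; rewrite (prev_0 _ k0).
by rewrite /psd_le -(prev_S x ki).
Qed.

Lemma prevD x y k : prev (x + y) k = prev x k + prev y k.
Proof. by rewrite -big_split. Qed.

Lemma prevZ s x k : prev (s *: x) k = s *: prev x k.
Proof. by rewrite scaler_sumr. Qed.

Lemma path_coneD x y : path_cone D j x -> path_cone D j y -> path_cone D j (x + y).
Proof.
move=> /path_coneP[sx px] /path_coneP[sy py]; apply/path_coneP.
split=> [|k]; first exact: path_spaceD.
by rewrite prevD opprD addrACA; exact: psdD.
Qed.

Lemma path_coneZ s x : 0 <= s -> path_cone D j x -> path_cone D j (s *: x).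
Proof.
move=> s0 /path_coneP[sx px]; apply/path_coneP.
split=> [|k]; first exact: path_spaceZ.
by rewrite prevZ -scalerBr; exact: psdZ.
Qed.

Lemma path_cone0 : path_cone D j (0 : path_type).
Proof.
apply/path_coneP; split=> [k|k]; first exact: symmetricmx0.
by rewrite /prev big1// subr0; exact: psd0.
Qed.

Lemma path_cone_le x i k : path_cone D j x -> (i <= k)%N -> psd (x k - x i).
Proof.
case=> sx x0 xS; case: k => m mn /=; elim: m mn => [|m IH] mn.
  rewrite leqn0 => /eqP i0; rewrite (_ : Ordinal mn = i) ?subrr; first exact: psd0.
  exact/val_inj.
rewrite leq_eqVlt => /predU1P[im|].
  rewrite (_ : Ordinal mn = i) ?subrr; first exact: psd0.
  exact/val_inj.
rewrite ltnS => im; have mn' := ltnW mn.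
rewrite -(subrK (x (Ordinal mn')) (x (Ordinal mn))) -addrA.
by apply: psdD; [exact: xS|exact: IH].
Qed.

Lemma path_cone_psd x k : path_cone D j x -> psd (x k).
Proof.
move=> Cx; have [sx x0 xS] := Cx.
rewrite -(subrK (x (Ordinal size_partition_gt0)) (x k)).
by apply: psdD; [exact: path_cone_le|apply: (psd_le0 _).1; exact: x0].
Qed.

Definition tail (m : nat) x : 'M[R]_D := \sum_(k < size j | (m <= k)%N) weight k *: x k.

Lemma tailS k x : tail k x = weight k *: x k + tail k.+1 x.
Proof.
rewrite /tail (bigD1 k)//=; congr (_ + _).
by apply: eq_bigl => i; rewrite ltn_neqAle eq_sym andbC.
Qed.

(** For the last index i both sides are empty sums. This is the index shift in the Abel
    summation. *)
Lemma tail_next i x : \sum_(k < size j | k == i.+1 :> nat) tail k x = tail i.+1 x.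
Proof.
have [iS|iS] := ltnP i.+1 (size j).
  by rewrite (big_pred1 (Ordinal iS)).
rewrite /tail [RHS]big_pred0 ?big_pred0// => k.
  by apply/negbTE; rewrite neq_ltn (leq_trans (ltn_ord k)).
by apply/negbTE; rewrite -ltnNge (leq_trans (ltn_ord k)).
Qed.

Lemma tailD m x y : tail m (x + y) = tail m x + tail m y.
Proof.
by rewrite -big_split; apply: eq_bigr => k _; exact: scalerDr.
Qed.

Lemma tailZ m s x : tail m (s *: x) = s *: tail m x.
Proof.
rewrite scaler_sumr; apply: eq_bigr => k _.
by rewrite [RHS]scalerA mulrC -scalerA.
Qed.

Lemma tailB m x y : tail m (x - y) = tail m x - tail m y.
Proof. by rewrite tailD -scaleN1r tailZ scaleN1r. Qed.

Lemma tail_sym m x : path_space x -> tail m x \is symmetricmx.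
Proof.
move=> sx; apply/symmetricmxP; rewrite linear_sum/=; apply: eq_bigr => k _.
by rewrite linearZ/=; have /symmetricmxP -> := sx k.
Qed.

Lemma tail_psd m x : (forall k, psd (x k)) -> psd (tail m x).
Proof. move=> px; apply: psd_sum => k _; apply: psdZ => //.
exact/ltW/weight_gt0. Qed.

Lemma form_tail m x (u v : 'cV[R]_D) : mxform (tail m x) u v =
  \sum_(k < size j | (m <= k)%N) weight k * mxform (x k) u v.
Proof.
rewrite /tail (big_morph (fun a => mxform a u v)
  (fun a b => formDm a b u v) (form0m u v)).
by apply: eq_bigr => k _; rewrite formZm.
Qed.

(** Abel summation: [weight k *: x k] is the difference of two consecutive tails, and the difference
    is moved onto y. *)
Lemma path_dot_tail x y :
  path_dot x y = \sum_(k < size j) \tr (tail k x *m (y k - prev y k)).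
Proof.
under [RHS]eq_bigr do rewrite mulmxBr linearB/=.
rewrite sumrB.
have -> : \sum_(k < size j) \tr (tail k x *m prev y k) =
    \sum_(i < size j) \tr (tail i.+1 x *m y i).
  under eq_bigr do rewrite mulmx_sumr linear_sum/= big_mkcond/=.
  rewrite exchange_big; apply: eq_bigr => i _.
  by rewrite -big_mkcond/= -tail_next mulmx_suml linear_sum/=.
rewrite -sumrB; apply: eq_bigr => k _.
by rewrite -linearB/= -mulmxBl tailS addrK -scalemxAl linearZ.
Qed.

(** Testing x against the path that jumps from 0 to u u^T at index k gives the form of [tail k x] at
    u. Conversely, Abel summation writes the pairing as a sum of traces of products of positive
    matrices. *)
Lemma dual_path_coneP x : dual_path_cone x <->
  path_space x /\ forall k, psd (tail k x).
Proof.
split=> [[sx dx]|[sx px]]; split=> //.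
  move=> k; apply/psdP; split=> [|u]; first exact: tail_sym.
  pose y i := if (k <= i)%N then u *m u^T else 0.
  have Cy : path_cone D j y.
    have py i : psd (y i).
      by rewrite /y; case: ifP => _; [exact: psd_outer|exact: psd0].
    split=> [i|i _|i i' i'E]; first exact/psd_sym.
    - by apply: (psd_le0 _).2.
    - rewrite /psd_le /y i'E; have [ki|ki] := leqP k i.
        by rewrite leqW// subrr; exact: psd0.
      rewrite subr0; case: ifP => _; [exact: psd_outer|exact: psd0].
  have := dx _ Cy; suff -> : path_dot x y = mxform (tail k x) u u by [].
  rewrite form_tail big_mkcond; apply: eq_bigr => i _.
  by rewrite /y; case: ifP => _; rewrite ?mulmx0 ?mxtrace0 ?mulr0// mxtrace_outer.
move=> y /path_coneP[sy py]; rewrite path_dot_tail.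
by apply: sumr_ge0 => k _; exact: psd_trace_ge0.
Qed.

Lemma path_cone_dual x : path_cone D j x -> dual_path_cone x.
Proof.
move=> Cx; apply/dual_path_coneP; split; first exact: path_cone_space.
by move=> k; apply: tail_psd => i; exact: path_cone_psd.
Qed.

(** The test path x below has k-th tail u u^T and all other tails 0, so that its pairing with z is
    the form of the k-th increment of z at u. *)
Lemma path_bidual y : path_space y ->
  (forall x, dual_path_cone x -> 0 <= path_dot y x) -> path_cone D j y.
Proof.
move=> sy hy; apply/path_coneP; split=> // k; apply/psdP; split=> [|u].
  apply: symmetricmxB; first exact: sy.
  by apply: (big_ind (fun a : 'M[R]_D => a \is symmetricmx)) => [||i _];
    [exact: symmetricmx0|exact: symmetricmxD|exact: sy].
pose x : path_type := fun i =>
  (weight i)^-1 *: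
    ((if i == k then u *m u^T else 0) - (if k == i.+1 :> nat then u *m u^T else 0)).
have dotx z : path_dot x z = mxform (z k - prev z k) u u.
  have trE (b : bool) (a : 'M[R]_D) :
      \tr ((if b then u *m u^T else 0) *m a) = if b then mxform a u u else 0.
    by case: b; rewrite ?mul0mx ?mxtrace0// mxtrace_mulC mxtrace_outer.
  transitivity (\sum_(i < size j) ((if i == k then mxform (z i) u u else 0) -
      (if k == i.+1 :> nat then mxform (z i) u u else 0))).
    apply: eq_bigr => i _; rewrite -/(weight i) /x -scalemxAl linearZ/=.
    have wi : weight i != 0 by rewrite gt_eqF ?weight_gt0.
    by rewrite (mulVKf wi) mulmxBl linearB/= !trE.
  rewrite sumrB -!big_mkcond/= big_pred1_eq formBm; congr (_ - _).
  by rewrite /prev (big_morph (fun a => mxform a u u)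
    (fun a b => formDm a b u u) (form0m u u)).
rewrite -dotx path_dotC; apply: hy; split=> [i|z /path_coneP[sz pz]].
  apply/symmetricmxZ/symmetricmxB; case: ifP => _; try exact: symmetricmx0;
  exact/psd_sym/psd_outer.
by rewrite dotx psd_form.
Qed.

Lemma tail_bound m x (e : R) : (forall k c d, `|x k c d| <= e) -> forall c d,
  `|tail m x c d| <= (\sum_(k < size j) weight k) * e.
Proof.
move=> xe c d; rewrite summxE (le_trans (ler_norm_sum _ _ _))//.
rewrite mulr_suml big_mkcond/=; apply: ler_sum => k _.
have w0 := ltW (weight_gt0 k).
have wx : `|weight k * x k c d| <= weight k * e.
  by rewrite normrM ger0_norm// ler_wpM2l.
by case: ifP => _; rewrite ?mxE// (le_trans _ wx).
Qed.

End cone.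

(** * Sublevel sets *)

Section level.
Variables (R : realType) (D : nat) (j : time_partition R).
Local Notation path_type := ('I_(size j) -> 'M[R]_D).
Local Notation n' := (last_index j).
(** K abstracts a sublevel set of g: [Kconvex], [Klower] and [Kray] reflect convexity, monotonicity
    and lower semicontinuity. [Kx0] says that x0 is a limit of points z lying below members of K in
    the dual order. *)
Variables (K : set path_type) (x0 : path_type).
Hypothesis Kcone : forall x, K x -> path_cone D j x.
Hypothesis Kconvex : forall x y (s : R), K x -> K y -> 0 <= s <= 1 ->
  K (s *: x + (1 - s) *: y).
Hypothesis Klower : forall x y, K x -> path_cone D j y ->
  dual_path_cone (x - y) -> K y.
Hypothesis Kray : forall x, path_cone D j x ->
  (forall s : R, 0 < s < 1 -> K ((1 - s) *: x)) -> K x.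
Hypothesis Cx0 : path_cone D j x0.
Hypothesis Kx0 : forall e : R, 0 < e -> exists x z,
  [/\ K x, path_space z, dual_path_cone (x - z) &
      forall k c d, `|z k c d - x0 k c d| <= e].

(* A member of [K] whose largest coordinate has maximal rank; by convexity,
   its kernel annihilates every other member. *)
Lemma max_rank_member : exists2 p, K p &
  forall x (u : 'cV[R]_D), K x -> p n' *m u = 0 -> forall k, x k *m u = 0.
Proof.
pose P m := `[< exists2 x, K x & \rank (x n') = m >].
have exP : exists m, P m.
  have [x [z [Kx _ _ _]]] := Kx0 ltr01.
  by exists (\rank (x n')); apply/asboolP; exists x.
have ubP m : P m -> (m <= D)%N by move=> /asboolP[x _ <-]; exact: rank_leq_row.
have [m /asboolP[p Kp pm] mmax] := ex_maxnP exP ubP.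
exists p => // x u Kx pu k; have Cx := Kcone Kx; have Cp := Kcone Kp.
suff xu : x n' *m u = 0.
  apply: psd_ker_le xu; first exact: path_cone_psd.
  exact/path_cone_le/leq_last_index.
apply: psd_rank_ker pu; try exact: path_cone_psd.
(* The midpoint of p and x lies in K, so by maximality the rank of [p n' + x n'] is at most m. *)
pose h : R := 2^-1.
have h1 : 0 <= h <= 1 by rewrite /h; lra.
rewrite pm; apply: mmax; apply/asboolP; exists (h *: p + (1 - h) *: x).
  exact: Kconvex.
have hh : 1 - h = h by rewrite /h; lra.
rewrite hh -scalerDr; rewrite (_ : (_ *: _) n' = h *: (p n' + x n'))//.
by rewrite mxrank_scale_nz// /h invr_eq0 pnatr_eq0.
Qed.

(** At u the total tail of x0 is at most an arbitrarily small error, since it is nearly dominated by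
    that of a member of K, which vanishes there. It is a sum of nonnegative terms with positive
    weights, so each term vanishes. *)
Lemma level_ker (u : 'cV[R]_D) : (forall x k, K x -> x k *m u = 0) ->
  forall k, x0 k *m u = 0.
Proof.
move=> Ku k; apply: psd_ker; first exact: path_cone_psd.
pose W := \sum_(k < size j) weight j k.
pose S := \sum_c \sum_d `|u c 0| * `|u d 0|.
have W0 : 0 <= W by apply: sumr_ge0 => i _; exact/ltW/weight_gt0.
have S0 : 0 <= S by do 2!apply: sumr_ge0 => ? _; rewrite mulr_ge0.
have bnd e : 0 < e -> mxform (tail 0 x0) u u <= W * S * e.
  move=> e0; have [x [z [Kx sz /dual_path_coneP[_ dxz] ze]]] := Kx0 e0.
  have tx : mxform (tail 0 x) u u = 0.
    by rewrite form_tail big1// => i _; rewrite form_kerr ?mulr0// Ku.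
  have := psd_form u (dxz (Ordinal (size_partition_gt0 j))) => /=.
  rewrite (_ : x - z = (x - x0) - (z - x0)); last first.
    by rewrite opprB addrA subrK.
  rewrite tailB formBm tailB formBm tx sub0r -opprD oppr_ge0 -lerBrDr sub0r.
  move=> /le_trans -> //; rewrite formE -sumrN.
  rewrite mulrAC mulr_sumr; apply: ler_sum => c _.
  rewrite -sumrN mulr_sumr; apply: ler_sum => d _.
  apply: (le_trans (ler_norm _)); rewrite normrN !normrM.
  have tb : `|tail 0 (z - x0) c d| <= W * e.
    by apply: tail_bound => i a b; have := ze i a b; rewrite !mxE.
  have := ler_wpM2l (mulr_ge0 (normr_ge0 (u c 0)) (normr_ge0 (u d 0))) tb.
  lra.
have t0 : mxform (tail 0 x0) u u <= 0.
  rewrite leNgt; apply/negP => tpos.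
  have WS : 0 <= W * S by exact: mulr_ge0.
  set t := mxform _ _ _ in tpos bnd.
  have W1 : 0 < W * S + 1 by lra.
  (* The bound becomes t (W S + 1) <= W S t, impossible for t > 0. *)
  have := bnd (t / (W * S + 1)) (divr_gt0 tpos W1).
  rewrite mulrA ler_pdivlMr//; lra.
apply/eqP; rewrite eq_le psd_form ?andbT; last exact: path_cone_psd.
have := t0; rewrite form_tail (bigD1 k)//=.
have : 0 <= \sum_(i < size j | i != k) weight j i * mxform (x0 i) u u.
  apply: sumr_ge0 => i _; apply: mulr_ge0; first exact/ltW/weight_gt0.
  exact: psd_form (path_cone_psd _ Cx0).
move=> h1 h2; have : weight j k * mxform (x0 k) u u <= 0 by lra.
by rewrite pmulr_rle0// weight_gt0.
Qed.

Lemma level_closed : K x0.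
Proof.
apply: Kray => // s /andP[s0 s1].
have [p Kp pker] := max_rank_member; have Cp := Kcone Kp.
have [C C0 dom] := psd_dom (path_cone_psd n' Cp).
pose W := \sum_(k < size j) weight j k.
have W0 : 0 <= W by apply: sumr_ge0 => i _; exact/ltW/weight_gt0.
have w0 := weight_gt0 n'.
have CW : 0 <= C * W by exact: mulr_ge0.
have CW1 : 0 < C * W + 1 by lra.
(* Chosen so that the error C W e from [dom] is covered by s times the last weight, the share of
   [p n'] in every tail of s p. *)
pose e := s * weight j n' / (C * W + 1).
have e0 : 0 < e by rewrite divr_gt0// mulr_gt0.
have CWe : C * (W * e) <= s * weight j n'.
  rewrite mulrA /e mulrA ler_pdivrMr// mulrC ler_wpM2l//; last lra.
  by rewrite mulr_ge0// ltW.
have [x [z [Kx sz /dual_path_coneP[_ dxz] ze]]] := Kx0 e0.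
have sx := path_cone_space (Kcone Kx); have sx0 := path_cone_space Cx0.
have x0ker (u : 'cV[R]_D) : p n' *m u = 0 -> forall k, x0 k *m u = 0.
  by move=> pu; apply: level_ker => y k Ky; exact: pker pu k.
apply: (@Klower (s *: p + (1 - s) *: x)).
- by apply: Kconvex => //; rewrite !ltW.
- by apply: path_coneZ => //; lra.
rewrite -addrA -scalerBr; apply/dual_path_coneP; split=> [|k].
  apply: path_spaceD; first exact/path_spaceZ/path_cone_space.
  exact/path_spaceZ/path_spaceB.
rewrite tailD !tailZ tailB.
have tp : psd (tail k p - weight j n' *: p n').
  rewrite /tail (bigD1 n')/= ?leq_last_index// addrAC subrr add0r.
  apply: psd_sum => i _; apply: psdZ; first exact/ltW/weight_gt0.
  exact: path_cone_psd.
have bm : psd (tail k x - tail k x0 + (C * (W * e)) *: p n').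
  apply: (dom _ (tail k (z - x0))).
  - by apply: symmetricmxB; exact: tail_sym.
  - move=> u pu; rewrite -tailB /tail mulmx_suml big1// => i _.
    rewrite -scalemxAl mulmxBl (pker _ _ Kx pu) (x0ker _ pu).
    by rewrite subrr scaler0.
  - by rewrite -!tailB opprB addrA subrK.
  - by apply: tail_bound => i c d; have := ze i c d; rewrite !mxE.
pose t := s * weight j n' - (1 - s) * (C * (W * e)).
(* Three positive terms: the tail of p without its last summand, the bound [bm], and a remaining
   multiple t of [p n'], with t >= 0 by the choice of e. *)
rewrite [X in psd X](_ : _ = s *: (tail k p - weight j n' *: p n') +
    ((1 - s) *: (tail k x - tail k x0 + (C * (W * e)) *: p n') + t *: p n')).
  apply: psdD; first by apply: psdZ => //; exact: ltW.
  apply: psdD; first by apply: psdZ => //; lra.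
  apply: psdZ; last exact: path_cone_psd.
  rewrite /t subr_ge0 (le_trans _ CWe)// ler_piMl//; last lra.
  by apply: mulr_ge0 => //; apply: mulr_ge0 => //; exact: ltW.
apply/matrixP => c d; rewrite /t !mxE; ring.
Qed.

End level.

(** * The Hahn-Banach argument *)

Section supporting_functional.
Variables (R : realType) (V : lmodType R).
Implicit Types (G : V -> R -> Prop) (v e : V).

(** A relation [G x r] plays the role of f x <= r for a convex function f, so that no infimum has to
    be formed. [invariant_along] then says that f is affine with slope c in the direction v. *)
Definition convex_rel G := forall x y a b (s : R), G x a -> G y b ->
  0 <= s <= 1 -> G (s *: x + (1 - s) *: y) (s * a + (1 - s) * b).

Definition nonneg_at0 G := forall r, G 0 r -> 0 <= r.

Definition invariant_along G v c := forall x r t, G x r -> G (x + t *: v) (r + t * c).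

(** Since 0 is a convex combination of points on its two sides, difference quotients from the left
    lie below those from the right; the supremum of the left ones separates them. *)
Lemma exists_slope G e : convex_rel G -> (forall x, exists r, G x r) ->
  nonneg_at0 G -> exists c, forall t r, G (t *: e) r -> t * c <= r.
Proof.
move=> convG totG G0.
have cross t1 t2 r1 r2 : t1 < 0 -> 0 < t2 -> G (t1 *: e) r1 -> G (t2 *: e) r2 ->
    r1 / t1 <= r2 / t2.
  move=> t10 t20 G1 G2.
  have t12 : 0 < t2 - t1 by lra.
  pose s := t2 / (t2 - t1).
  have s01 : 0 <= s <= 1.
    by rewrite divr_ge0 ?(ltW t12) ?(ltW t20)//= ler_pdivrMr//; lra.
  have := convG _ _ _ _ _ G1 G2 s01.
  rewrite !scalerA -scalerDl (_ : s * t1 + (1 - s) * t2 = 0); last first.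
    by rewrite /s; field; lra.
  rewrite scale0r => /G0.
  rewrite (_ : s * r1 + (1 - s) * r2 = (t2 * r1 - t1 * r2) / (t2 - t1)); last first.
    by rewrite /s; field; lra.
  rewrite pmulr_lge0 ?invr_gt0// => h.
  rewrite ler_pdivlMr// mulrAC ler_ndivrMr//; lra.
pose A : set R := [set x | exists t r, [/\ t < 0, G (t *: e) r & x = r / t]].
have A0 : A !=set0.
  have [r Gr] := totG ((-1) *: e).
  by exists (r / -1); exists (-1), r; split => //; lra.
have ubA t r : 0 < t -> G (t *: e) r -> ubound A (r / t).
  by move=> t0 Gr _ [t1 [r1 [t10 Gr1 ->]]]; exact: cross t10 t0 Gr1 Gr.
exists (sup A) => t r Gr; have [t0|t0|t0] := ltgtP t 0.
- rewrite mulrC -ler_ndivrMr//; apply: ub_le_sup; last by exists t, r.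
  have [r1 Gr1] := totG (1 *: e).
  by exists (r1 / 1); exact: ubA Gr1.
- rewrite mulrC -ler_pdivlMr//; apply: ge_sup => //; exact: ubA.
- by rewrite t0 mul0r; apply: G0; rewrite t0 scale0r in Gr.
Qed.

(* The Hahn-Banach extension step, one direction at a time, for the convex
   function whose epigraph is [G]: [c] is a slope of this function along [e], and
   [H] is [G] saturated by the translations along (e, c). *)
Lemma invariant_enlargement (s : seq V) G : convex_rel G ->
  (forall x, exists r, G x r) -> nonneg_at0 G ->
  exists H : V -> R -> Prop, [/\ forall x r, G x r -> H x r, convex_rel H,
    nonneg_at0 H & {in s, forall e, exists c, invariant_along H e c}].
Proof.
move=> convG totG G0; elim: s => [|e s [H [GH convH H0 invH]]].
  by exists G; split.
have totH x : exists r, H x r by have [r /GH] := totG x; exists r.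
have [c cP] := exists_slope e convH totH H0.
exists (fun v r => exists t, H (v + t *: e) (r + t * c)); split.
- by move=> x r /GH Hx; exists 0; rewrite scale0r mul0r !addr0.
- move=> x y a b u [t Ht] [t' Ht'] u01; exists (u * t + (1 - u) * t').
  have := convH _ _ _ _ _ Ht Ht' u01; rewrite !scalerDr !scalerA addrACA -scalerDl.
  by congr (H _ _); ring.
- by move=> r [t]; rewrite add0r => /cP; lra.
move=> e'; rewrite inE => /predU1P[->|e's].
  exists c => x r t [t' Ht']; exists (t' - t).
  rewrite -addrA -scalerDl (_ : t + (t' - t) = t'); last by ring.
  by rewrite (_ : r + t * c + (t' - t) * c = r + t' * c); last by ring.
have [c' c'P] := invH _ e's; exists c' => x r t [t' Ht']; exists t'.
rewrite addrAC (_ : r + t * c' + t' * c = (r + t' * c) + t * c'); last by ring.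
exact: c'P.
Qed.

(** Once the enlarged relation is invariant along every e_i, the point sum a_i e_i can be translated
    to 0 term by term. This lowers r by sum a_i c_i, and nonnegativity at 0 concludes. *)
Lemma supporting_functional (I : finType) (e : I -> V) G : convex_rel G ->
  (forall x, exists r, G x r) -> nonneg_at0 G ->
  exists c : I -> R, forall (a : I -> R) r,
    G (\sum_i a i *: e i) r -> \sum_i a i * c i <= r.
Proof.
move=> convG totG G0.
have [H [GH _ H0 invH]] := invariant_enlargement (map e (enum I)) convG totG G0.
have /choice[c cP] i : exists c, invariant_along H (e i) c.
  by apply: invH; rewrite map_f// mem_enum.
exists c => a r /GH Hr.
have step (s : seq I) : H (\sum_i a i *: e i - \sum_(i <- s) a i *: e i)
    (r - \sum_(i <- s) a i * c i).
  elim: s => [|i s IH]; first by rewrite !big_nil !subr0.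
  have := cP i _ _ (- a i) IH; rewrite !big_cons scaleNr !opprD.
  by rewrite addrAC -addrA; congr (H _ _); ring.
have := step (index_enum I); rewrite subrr => /H0; lra.
Qed.

End supporting_functional.

(** * Continuity of the pairing and closedness of the cone *)

Lemma sum_continuous (R : realType) (T : topologicalType) (I : Type)
    (r : seq I) (P : pred I) (F : I -> T -> R) :
  (forall i, continuous (F i)) ->
  continuous (fun x => \sum_(i <- r | P i) F i x).
Proof.
move=> Fc; apply: (@continuous_big R I +%R 0 P _ T r F) => // x.
exact: add_continuous.
Qed.

Section topology.
Variables (R : realType) (D : nat) (j : time_partition R).
Local Notation path_type := ('I_(size j) -> 'M[R]_D).
Implicit Types (x y z v : path_type).

Lemma entry_continuous k c d : continuous (fun x : path_type => x k c d).
Proof.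
move=> x; apply: (@continuous_comp _ _ _ (fun x : path_type => x k)
  (fun a : 'M[R]_D => a c d)); last exact: coord_continuous.
exact: (@proj_continuous _ (fun=> 'M[R]_D : topologicalType)).
Qed.

Lemma path_dot_continuous y : continuous (path_dot y).
Proof.
have -> : path_dot y = fun x =>
    \sum_(k < size j) \sum_c \sum_d weight j k * y k c d * x k d c.
  apply/funext => x; apply: eq_bigr => k _; rewrite /mxtrace mulr_sumr.
  apply: eq_bigr => c _; rewrite mxE mulr_sumr.
  by apply: eq_bigr => d _; rewrite mulrA.
do 3!apply: sum_continuous => ?; move=> x.
apply: (@cvgMl_tmp _ _ (nbhs x) (nbhs_filter x)); exact: entry_continuous.
Qed.

(** The bidual theorem presents the cone as an intersection of closed half-spaces, from which
    closedness is read off. *)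
Lemma path_coneE : path_cone D j = @path_space R D j `&`
  \bigcap_(v in [set v | dual_path_cone v]) path_dot v @^-1` [set r | 0 <= r].
Proof.
apply/seteqP; split=> x.
  move=> Cx; split; first exact: path_cone_space.
  by move=> v [_ dv]; exact: dv.
by case=> sx dx; apply: path_bidual => // v dv; rewrite path_dotC; exact: dx.
Qed.

Lemma path_space_closed : closed (@path_space R D j).
Proof.
rewrite (_ : @path_space R D j = \bigcap_(k in [set: 'I_(size j)])
    \bigcap_(c in [set: 'I_D]) \bigcap_(d in [set: 'I_D])
    (fun x : path_type => x k c d - x k d c) @^-1` [set 0]).
  do 3!apply: closed_bigI => ? _.
  apply: preimage_closed; last exact: closed_eq.
  by move=> x _; apply: (@cvgB _ _ _ (nbhs x) (nbhs_filter x)); exact: entry_continuous.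
apply/seteqP; split=> x.
  by move=> sx k _ c _ d _; rewrite /= (symmetricmxE (sx k)) subrr.
move=> sx k; apply/symmetricmxP/matrixP => c d; rewrite mxE.
by apply/esym/eqP; rewrite -subr_eq0; apply/eqP; exact: sx.
Qed.

Lemma path_cone_closed : closed (path_cone D j).
Proof.
rewrite path_coneE; apply: closedI; first exact: path_space_closed.
apply: closed_bigI => v _; apply: preimage_closed; last exact: closed_ge.
by move=> x _; exact: path_dot_continuous.
Qed.

Lemma path_cone_closed_convex : closed_convex_cone (path_cone D j).
Proof.
split; [exact: path_cone_closed| |exact: path_cone0|].
  move=> x y s; rewrite !inE => Cx Cy.
  have s0 : 0 <= s%:num by [].
  have s1 : 0 <= 1 - s%:num by rewrite subr_ge0.
  exact: path_coneD (path_coneZ s0 Cx) (path_coneZ s1 Cy).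
by move=> s x; exact: path_coneZ.
Qed.

Lemma scale_path_cvg x : (1 - s) *: x @[s --> (0 : R)^'+] --> x.
Proof.
apply/(@pointwise_cvgP (discrete_topology 'I_(size j)) 'M[R]_D) => k.
rewrite -[X in _ --> X]scale1r -{2}(subr0 1).
apply: cvgZl; apply: cvgB; first exact: cvg_cst.
exact/cvg_at_right_filter/cvg_id.
Qed.

End topology.

(** * Fenchel-Moreau duality *)

Section duality.
Variables (R : realType) (D : nat) (j : time_partition R).
Local Notation path_type := ('I_(size j) -> 'M[R]_D).
Implicit Types (x y z v : path_type).
Variable g : path_type -> \bar R.
Hypothesis gNy : forall x, path_cone D j x -> (-oo < g x)%E.
Hypothesis g_proper : exists2 x, path_cone D j x & g x <> +oo%E.

(** The slope is confined to the cone because the outer supremum of the biconjugate runs over it. *)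
Definition affine_minorant y (b : R) :=
  path_cone D j y /\
  forall x, path_cone D j x -> ((path_dot y x - b)%:E <= g x)%E.

Lemma conjugate_le_minorant y b : path_cone D j y ->
  (monotone_conjugate g y <= b%:E)%E <-> affine_minorant y b.
Proof.
move=> Cy; split.
  move=> hb; split=> // x Cx.
  have := gNy Cx; have : ((path_dot y x)%:E - g x <= b%:E)%E.
    rewrite path_dotC in hb *; apply: le_trans hb; apply: ereal_sup_ubound.
    by exists x => //; rewrite path_dotC.
  by case: (g x) => [r| |]//= + _; rewrite ?leey// !lee_fin; lra.
case=> _ min; apply: ge_ereal_sup => _ [x Cx <-].
have := gNy Cx; have := min _ Cx; rewrite path_dotC.
by case: (g x) => [r| |]//= + _; rewrite ?leNye// !lee_fin; lra.
Qed.

Lemma conjugate_gtNy y : (-oo < monotone_conjugate g y)%E.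
Proof.
have [x Cx gx] := g_proper.
apply: (@lt_le_trans _ _ ((path_dot x y)%:E - g x)%E).
  by have := gNy Cx; move: gx; case: (g x) => [r| |]//= _ _; exact: ltNyr.
by apply: ereal_sup_ubound; exists x.
Qed.

Lemma biconjugate_ge y b x : affine_minorant y b ->
  ((path_dot y x - b)%:E <= monotone_biconjugate g x)%E.
Proof.
move=> mb; have Cy := mb.1; have /(conjugate_le_minorant _ Cy) hb := mb.
apply: (@le_trans _ _ ((path_dot y x)%:E - monotone_conjugate g y)%E).
  have := conjugate_gtNy y; move: hb.
  by case: (monotone_conjugate g y) => [r| |]//= + _; rewrite !lee_fin; lra.
by apply: ereal_sup_ubound; exists y.
Qed.

Lemma biconjugate_gt x a : (a%:E < monotone_biconjugate g x)%E ->
  exists y b, affine_minorant y b /\ a < path_dot y x - b.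
Proof.
move=> /ereal_sup_gt[_ [y Cy <-]].
have := conjugate_gtNy y; case E : (monotone_conjugate g y) => [b| |]//= _.
rewrite lte_fin => ab; exists y, b; split=> //.
by apply/(conjugate_le_minorant _ Cy); rewrite E.
Qed.

Lemma biconjugate_le x : path_cone D j x -> (monotone_biconjugate g x <= g x)%E.
Proof.
move=> Cx; rewrite leNgt; apply/negP => gx.
have gfin : g x = (fine (g x))%:E.
  by have := gNy Cx; move: gx; case: (g x) => [r| |]//; rewrite ltNge leey.
move: gx; rewrite gfin => /biconjugate_gt[y [b [[_ min]]]].
by have := min _ Cx; rewrite gfin lee_fin; lra.
Qed.

(** The biconjugate is the supremum of the affine minorants with slope in the cone. Quantifying over
    real a < g x treats finite and infinite values of g alike. *)
Lemma biconjugate_eqP :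
  (forall x, path_cone D j x -> monotone_biconjugate g x = g x) <->
  (forall x a, path_cone D j x -> (a%:E < g x)%E ->
    exists y b, affine_minorant y b /\ a < path_dot y x - b).
Proof.
split=> [gg x a Cx ax|H x Cx]; first by apply: biconjugate_gt; rewrite gg.
apply/eqP; rewrite eq_le biconjugate_le//= leNgt; apply/negP.
have min a : (a%:E < g x)%E -> (a%:E < monotone_biconjugate g x)%E.
  move=> /(H _ _ Cx)[y [b [mb ab]]].
  by rewrite (lt_le_trans _ (biconjugate_ge x mb))// lte_fin.
case E : (monotone_biconjugate g x) => [r| |] gx.
- by have := min _ gx; rewrite E ltxx.
- by move: gx; rewrite ltNge leey.
have [a ax] : exists a, (a%:E < g x)%E.
  case: (g x) gx => [r _| _|//]; first by exists (r - 1); rewrite lte_fin; lra.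
  by exists 0; exact: ltry.
by have := min _ ax; rewrite E.
Qed.

Section minorants.
Hypothesis g_minorants : forall x a, path_cone D j x -> (a%:E < g x)%E ->
  exists y b, affine_minorant y b /\ a < path_dot y x - b.

Lemma minorants_convex : convex_on_cone g.
Proof.
move=> x y s Cx Cy /andP[s0 s1].
(* At the endpoints 0 times an infinite value counts as 0; for 0 < s < 1 an infinite value makes the
   right-hand side infinite. *)
have [->|sN0] := eqVneq s 0.
  by rewrite subr0 scale0r scale1r add0r mul0e mul1e add0e.
have [->|sN1] := eqVneq s 1.
  by rewrite subrr scale0r scale1r addr0 mul0e mul1e adde0.
have sp : 0 < s by rewrite lt_def sN0.
have s1p : 0 < 1 - s by rewrite subr_gt0 lt_def eq_sym sN1.
have := gNy Cx; have := gNy Cy.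
case Ey : (g y) => [q| |]//; case Ex : (g x) => [p| |]// _ _;
  rewrite ?gt0_muley ?lte_fin// ?leey//.
rewrite leNgt; apply/negP => /g_minorants[].
  by apply: path_coneD; apply: path_coneZ => //; exact: ltW.
move=> z [b [[_ min]]]; rewrite path_dotDr !path_dotZr.
have := min _ Cx; have := min _ Cy; rewrite Ex Ey !lee_fin.
move=> hy hx.
have := ler_wpM2l s0 hx; have := ler_wpM2l (ltW s1p) hy; lra.
Qed.

Lemma minorants_lsc : lsc_on_cone g.
Proof.
(* Points outside the cone are isolated in the subspace topology, so {x} is a neighbourhood. *)
move=> x a ax; have [Cx|NCx] := pselect (path_cone D j x); last first.
  exists [set x] => [|y ->//].
  by rewrite /nbhs/= -nbhs_subspace_out//.
have [y [b [[Cy min] ab]]] := g_minorants Cx ax.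
have ab' : a + b < path_dot y x by lra.
have near_gt : nbhs (x : path_type) [set z | a + b < path_dot y z].
  have gtn : nbhs (path_dot y x) [set r | a + b < r].
    by apply: open_nbhs_nbhs; split; [exact: open_gt|].
  exact: (@path_dot_continuous R D j y (x : path_type) _ gtn).
exists [set z | path_cone D j z /\ a + b < path_dot y z].
  rewrite /nbhs/= -nbhs_subspace_in//; apply: filterS near_gt => z abz Cz.
  by split.
move=> z [Cz abz]; apply: lt_le_trans (min _ Cz).
by rewrite lte_fin; lra.
Qed.

Lemma minorants_increasing : dual_increasing g.
Proof.
move=> x x' Cx Cx' dxx'; rewrite leNgt; apply/negP => gx.
have gfin : g x = (fine (g x))%:E.
  by have := gNy Cx; move: gx; case: (g x) => [r| |]//; rewrite ltNge leey.
move: gx; rewrite gfin => /(g_minorants Cx')[y [b [[Cy min] ab]]].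
have := min _ Cx; rewrite gfin lee_fin => yx.
by have := dxx'.2 _ Cy; rewrite path_dotC path_dotBr; lra.
Qed.

End minorants.

End duality.

(** * Coordinates and linear functionals on paths *)

Section path_functionals.
Variables (R : realType) (D : nat) (j : time_partition R).
Local Notation path_type := ('I_(size j) -> 'M[R]_D).
Implicit Types (x y z v : path_type).

Definition path_norm1 x : R := \sum_(k < size j) \sum_c \sum_d `|x k c d|.

Lemma path_norm1_convex (s : R) x y : 0 <= s <= 1 ->
  path_norm1 (s *: x + (1 - s) *: y) <= s * path_norm1 x + (1 - s) * path_norm1 y.
Proof.
move=> /andP[s0 s1]; rewrite /path_norm1 !mulr_sumr -big_split; apply: ler_sum => k _.
rewrite !mulr_sumr -big_split; apply: ler_sum => c _.
rewrite !mulr_sumr -big_split; apply: ler_sum => d _ /=.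
rewrite !mxE (le_trans (ler_normD _ _))// !normrM.
by rewrite (ger0_norm s0) (@ger0_norm _ (1 - s)) ?subr_ge0.
Qed.

Lemma path_norm1_entry x k c d : `|x k c d| <= path_norm1 x.
Proof.
rewrite /path_norm1 (bigD1 k)//= (bigD1 c)//= (bigD1 d)//= -!addrA lerDl.
by do ?[exact: normr_ge0|apply: addr_ge0|apply: sumr_ge0 => ? _].
Qed.

Lemma path_norm1_0 : path_norm1 0 = 0.
Proof. by do 3![rewrite /path_norm1; apply: big1 => ? _]; rewrite mxE normr0. Qed.

Local Notation index := ('I_(size j) * 'I_D * 'I_D)%type.

(** Matrix units form a basis of all matrix-valued paths, not of H^j; symmetry is restored in
    [path_dot_represents]. *)
Definition path_delta (i : index) : path_type :=
  fun k => if k == i.1.1 then delta_mx i.1.2 i.2 else 0.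

Lemma path_sum_delta x :
  x = \sum_(i : index) x i.1.1 i.1.2 i.2 *: path_delta i.
Proof.
have scaleE (s : R) (f : path_type) k c d : (s *: f) k c d = s * f k c d.
  by rewrite (_ : (s *: f) k = s *: f k)// mxE.
apply/funext => k; rewrite fct_sumE; apply/matrixP => c d; rewrite summxE.
rewrite (bigD1 (k, c, d))//= big1 ?addr0.
  by rewrite scaleE /path_delta/= eqxx mxE !eqxx mulr1.
move=> [[k' c'] d']; rewrite !xpair_eqE/= => ne.
rewrite scaleE /path_delta/=; have [kk|kk] := eqVneq k k'; last by rewrite mxE mulr0.
move: ne; rewrite kk eqxx/= negb_and mxE => /orP[] ne.
  by rewrite eq_sym (negbTE ne) mulr0.
by rewrite [d == _]eq_sym (negbTE ne) andbF mulr0.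
Qed.

(** Symmetrizing the coefficients does not change the functional on symmetric paths; dividing by the
    weights compensates those in [path_dot]. *)
Lemma path_dot_represents (c : index -> R) : exists2 y, path_space y &
  forall x, path_space x -> \sum_i x i.1.1 i.1.2 i.2 * c i = path_dot y x.
Proof.
pose y : path_type := fun k => \matrix_(a, b)
  ((c (k, a, b) + c (k, b, a)) / (2 * weight j k)).
exists y => [k|x sx].
  by apply/symmetricmxP/matrixP => a b; rewrite !mxE addrC.
transitivity (\sum_(k < size j) \sum_a \sum_b x k a b * c (k, a, b)).
  by rewrite pair_bigA pair_bigA; apply: eq_bigr => -[[]].
apply: eq_bigr => k _.
have wk : weight j k != 0 by rewrite gt_eqF ?weight_gt0.
have -> : weight j k * \tr (y k *m x k) =
    \sum_a \sum_b (c (k, a, b) + c (k, b, a)) / 2 * x k a b.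
  rewrite mulr_sumr; apply: eq_bigr => a _; rewrite mxE mulr_sumr.
  apply: eq_bigr => b _; rewrite mxE (symmetricmxE (sx k)).
  by field.
have swap : \sum_a \sum_b x k a b * c (k, b, a) = \sum_a \sum_b x k a b * c (k, a, b).
  rewrite exchange_big; apply: eq_bigr => a _; apply: eq_bigr => b _.
  by rewrite (symmetricmxE (sx k)).
transitivity (2^-1 * (\sum_a \sum_b x k a b * c (k, a, b)) +
    2^-1 * (\sum_a \sum_b x k a b * c (k, b, a))).
  by rewrite swap; lra.
rewrite !mulr_sumr -big_split; apply: eq_bigr => a _ /=.
rewrite !mulr_sumr -big_split; apply: eq_bigr => b _ /=; ring.
Qed.

End path_functionals.

(** * Affine minorants of convex, lower semicontinuous, increasing functions *)

Section converse.
Variables (R : realType) (D : nat) (j : time_partition R).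
Local Notation path_type := ('I_(size j) -> 'M[R]_D).
Implicit Types (x y z v : path_type).
Variable g : path_type -> \bar R.
Hypothesis gNy : forall x, path_cone D j x -> (-oo < g x)%E.
Hypothesis g_proper : exists2 x, path_cone D j x & g x <> +oo%E.
Hypothesis g_convex : convex_on_cone g.
Hypothesis g_lsc : lsc_on_cone g.
Hypothesis g_increasing : dual_increasing g.

Lemma min_at0 : exists m : R, forall x, path_cone D j x -> (m%:E <= g x)%E.
Proof.
pose o : path_type := 0; have Co : path_cone D j o by exact: path_cone0.
have g0 x : path_cone D j x -> (g o <= g x)%E.
  by move=> Cx; apply: g_increasing => //; rewrite subr0; exact: path_cone_dual.
exists (fine (g o)) => x Cx; rewrite fineK ?g0//.
have [p Cp gp] := g_proper.
by rewrite fin_real// gNy//= (le_lt_trans (g0 _ Cp))// ltey; apply/eqP.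
Qed.

(** A neighbourhood of x on which g > a would contain (1 - s) x for small s > 0. *)
Lemma lsc_ray x (a : R) : path_cone D j x ->
  (forall s : R, 0 < s < 1 -> (g ((1 - s) *: x)%R <= a%:E)%E) -> (g x <= a%:E)%E.
Proof.
move=> Cx gs; rewrite leNgt; apply/negP => ax.
have [V] := g_lsc (x := x : subspace (path_cone D j)) ax.
rewrite /nbhs/= -nbhs_subspace_in// => Vx gV.
have Vs : \forall s \near (0 : R)^'+, path_cone D j ((1 - s) *: x) -> V ((1 - s) *: x).
  exact: (scale_path_cvg Vx).
have [s [/andP[s0 s1] Vs']] : exists s : R, 0 < s < 1 /\
    (path_cone D j ((1 - s) *: x) -> V ((1 - s) *: x)).
  apply: (@filter_ex _ (0 : R)^'+); near=> s; split; last by near: s.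
  by apply/andP; split; near: s; [exact: nbhs_right_gt|exact: nbhs_right_lt].
have s1' : 0 <= 1 - s by lra.
by have /gV := Vs' (path_coneZ s1' Cx); rewrite ltNge gs ?s0.
Unshelve. all: by end_near. Qed.

(* This is the lower semicontinuity of the extension [h] at [x0]. *)
Lemma sublevel_separated x0 (b : R) : path_cone D j x0 -> (b%:E < g x0)%E ->
  exists2 e : R, 0 < e & forall x z, path_cone D j x -> (g x <= b%:E)%E ->
    path_space z -> dual_path_cone (x - z) -> e <= path_norm1 (z - x0).
Proof.
move=> Cx0 bx0; apply/not_notP => H.
pose K : set path_type := [set x | path_cone D j x /\ (g x <= b%:E)%E].
(* If no e works, points z come arbitrarily close to x0, and [level_closed] puts x0 in K, against b
   < g x0. *)
suff [_] : K x0 by rewrite leNgt bx0.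
apply: level_closed => //.
- by move=> x [].
- move=> x y s [Cx gx] [Cy gy] s01; have /andP[s0 s1] := s01.
  split; first by apply: path_coneD; apply: path_coneZ => //; lra.
  apply: (le_trans (g_convex Cx Cy s01)).
  have -> : b%:E = (s%:E * b%:E + (1 - s)%:E * b%:E)%E.
    by rewrite -!EFinM -EFinD; congr (_%:E); ring.
  by apply: leeD; apply: lee_wpmul2l => //; rewrite lee_fin; lra.
- move=> x y [Cx gx] Cy dxy; split=> //; exact: le_trans (g_increasing Cx Cy dxy) gx.
- move=> x Cx Ks; split=> //; apply: lsc_ray => // s s01.
  by have [] := Ks _ s01.
move=> e e0; apply/not_notP => noxz; apply: H; exists e => // x z Cx gx sz dxz.
rewrite leNgt; apply/negP => ze; apply: noxz; exists x, z; split=> // k c d.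
by have := path_norm1_entry (z - x0) k c d; rewrite !mxE => /le_trans; apply; exact: ltW.
Qed.

Lemma exists_minorant x0 (a : R) : path_cone D j x0 -> (a%:E < g x0)%E ->
  exists y b, affine_minorant g y b /\ a < path_dot y x0 - b.
Proof.
move=> Cx0 ax0.
(* The minorant will take the value a' at x0, which leaves the strict inequality a < a'. *)
have [a' aa' ax0'] : exists2 a', a < a' & (a'%:E < g x0)%E.
  case: (g x0) ax0 => [r| |//].
    by rewrite lte_fin => ar; exists ((a + r) / 2); rewrite ?lte_fin; lra.
  by move=> _; exists (a + 1); [lra|exact: ltry].
have [m minm] := min_at0.
have [e e0 sep] := sublevel_separated Cx0 ax0'.
(* From distance e on, the penalty l e makes up for the gap between a' and the lower bound m of
   g. *)
pose l : R := Num.max 0 (a' - m) / e.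
have l0 : 0 <= l by rewrite divr_ge0 ?le_max ?lexx// ltW.
have lm : a' - m <= l * e.
  by rewrite /l divfK ?gt_eqF// le_max lexx orbT.
have sx0 := path_cone_space Cx0.
(* [G] is the epigraph of the infimal convolution of [h - a'] and [l |.|_1],
   recentred at [x0]: the penalty makes it finite everywhere. *)
pose G (u : path_type) (t : R) := exists x z r, [/\ path_cone D j x,
  path_space z, dual_path_cone (x - z), (g x <= r%:E)%E &
  r - a' + l * path_norm1 (z - x0 - u) <= t].
have convG : convex_rel G.
  move=> u1 u2 t1 t2 s [x1 [z1 [r1 [Cx1 sz1 d1 g1 h1]]]].
  move=> [x2 [z2 [r2 [Cx2 sz2 d2 g2 h2]]]] s01; have /andP[s0 s1] := s01.
  have s1' : 0 <= 1 - s by lra.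
  exists (s *: x1 + (1 - s) *: x2), (s *: z1 + (1 - s) *: z2), (s * r1 + (1 - s) * r2).
  split.
  - by apply: path_coneD; apply: path_coneZ.
  - by apply: path_spaceD; apply: path_spaceZ.
  - rewrite opprD addrACA -!scalerBr; split.
      by apply: path_spaceD; apply: path_spaceZ; [case: d1|case: d2].
    move=> y Cy; rewrite path_dotDl !path_dotZl addr_ge0// mulr_ge0//.
      exact: d1.2.
    exact: d2.2.
  - apply: (le_trans (g_convex Cx1 Cx2 s01)).
    rewrite [leRHS](_ : _ = s%:E * r1%:E + (1 - s)%:E * r2%:E)%E//.
    by apply: leeD; apply: lee_wpmul2l => //; rewrite lee_fin; lra.
  have -> : s *: z1 + (1 - s) *: z2 - x0 - (s *: u1 + (1 - s) *: u2) =
      s *: (z1 - x0 - u1) + (1 - s) *: (z2 - x0 - u2).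
    by apply/funext => k; apply/matrixP => c d; rewrite !mxE; ring.
  have h := ler_wpM2l l0 (path_norm1_convex (z1 - x0 - u1) (z2 - x0 - u2) s01).
  have := ler_wpM2l s0 h1; have := ler_wpM2l s1' h2.
  lra.
have [p Cp gp] := g_proper.
have [q gq] : exists q, g p = q%:E.
  by have := gNy Cp; move: gp; case: (g p) => [r| |]// _ _; exists r.
have dual0 : dual_path_cone (0 : path_type) by apply/path_cone_dual/path_cone0.
have totG u : exists t, G u t.
  exists (q - a' + l * path_norm1 (p - x0 - u)), p, p, q; split=> //.
  - exact: path_cone_space.
  - by rewrite subrr.
  - by rewrite gq.
have G0 : nonneg_at0 G.
  move=> t [x [z [r [Cx sz dxz gx]]]]; rewrite subr0; apply: le_trans.
  have mr : m <= r by rewrite -lee_fin (le_trans _ gx)// minm.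
  have N0 : 0 <= path_norm1 (z - x0) by do 3!apply: sumr_ge0 => ? _.
  (* If r <= a', then [sep] keeps z at distance at least e from x0, and the penalty outweighs r - a'
     >= m - a'. *)
  have [ra|ra] := leP r a'; last first.
    by have := mulr_ge0 l0 N0; lra.
  have gxa : (g x <= a'%:E)%E by rewrite (le_trans gx)// lee_fin.
  have := ler_wpM2l l0 (sep _ _ Cx gxa sz dxz); lra.
have [c cP] := supporting_functional (@path_delta R D j) convG totG G0.
have [y sy yE] := path_dot_represents c.
have yP x z r : path_cone D j x -> path_space z -> dual_path_cone (x - z) ->
    (g x <= r%:E)%E -> path_dot y z - path_dot y x0 <= r - a'.
  move=> Cx sz dxz gx; rewrite -path_dotBr -yE; last exact: path_spaceB.
  (* The choice u = z - x0 makes the penalty vanish. *)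
  apply: cP; rewrite -path_sum_delta; exists x, z, r; split=> //.
  by rewrite subrr path_norm1_0 mulr0 addr0.
have Cy : path_cone D j y.
  (* If y . v < 0, the paths p - t v stay below p in the dual order while their pairing with y is
     unbounded; the t below overshoots the bound by 1. *)
  apply: path_bidual => // v dv; rewrite leNgt; apply/negP => yv.
  have yvt t : 0 <= t -> path_dot y p - t * path_dot y v - path_dot y x0 <= q - a'.
    move=> t0; rewrite -path_dotZr -path_dotBr.
    apply: (yP p); rewrite ?gq//.
      by apply: path_spaceB; [exact: path_cone_space|apply: path_spaceZ; case: dv].
    rewrite opprB addrC subrK; split; first by apply: path_spaceZ; case: dv.
    by move=> x Cx; rewrite path_dotZl mulr_ge0//; exact: dv.2.
  have h0 := yvt 0 (lexx 0).
  pose t := (q - a' - path_dot y p + path_dot y x0 + 1) / - path_dot y v.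
  have t0 : 0 <= t by rewrite divr_ge0//; lra.
  have := yvt t t0.
  have -> : t * path_dot y v = - (q - a' - path_dot y p + path_dot y x0 + 1).
    by rewrite /t invrN mulrN mulNr divfK// lt_eqF.
  lra.
exists y, (path_dot y x0 - a'); split; last by lra.
split=> // x Cx; have := gNy Cx; case E : (g x) => [r| |]// _; last exact: leey.
rewrite lee_fin; have gr : (g x <= r%:E)%E by rewrite E.
have := yP _ x _ Cx (path_cone_space Cx) _ gr; rewrite subrr => /(_ dual0); lra.
Qed.

End converse.

Theorem propositionB1 (R : realType) (D : nat) (hD : (0 < D)%N)
    (j : time_partition R) :
  closed_convex_cone (path_cone D j) /\ fenchel_moreau_property D j.
Proof.
split; first exact: path_cone_closed_convex.
move=> g gNy g_proper; rewrite (biconjugate_eqP gNy g_proper).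
split=> [H|[gc gl gi] x a Cx ax]; last exact: exists_minorant.
split; [exact: minorants_convex|exact: minorants_lsc|exact: minorants_increasing].
Qed.
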